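(* Let $r\ge 2$ and $\alpha\ge 1$ be integers and let $G$ be a graph with independence number $\alpha(G)=\alpha$ whose edges are colored with $r$ colors. Then $V(G)$ can be covered by the vertex sets of $r\alpha$ monochromatic connected subgraphs of $G$, each of diameter at most $2$. In other words, $g(r,2,\alpha)\le r\alpha$.
   Context: Graphs are finite and simple. A monochromatic subgraph is a subgraph (not necessarily induced) all of whose edges have the same color; a single vertex counts as a monochromatic subgraph. Different subgraphs in a cover may have different colors, and need not be disjoint or distinct. The diameter of a graph $H$ is the smallest integer $d$ with $d_H(u,v)\le d$ for all $u,v\in V(H)$, where distances are measured in $H$ itself ($\infty$ if there is no path); a one-vertex graph has diameter $0$. $g(r,d,\alpha)$ denotes the minimum $k$ such that for every graph $G$ with $\alpha(G)=\alpha$ and every coloring of the edges of $G$ with $r$ colors, $V(G)$ can be covered by the vertex sets of $k$ monochromatic subgraphs of diameter at most $d$. *)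

(* Defs.v *)
From mathcomp Require Import all_boot.

Set Implicit Arguments.
Unset Strict Implicit.
Unset Printing Implicit Defensive.

Record sgraph := SGraph {
  vertex :> finType;
  adj : rel vertex;
  adj_sym : symmetric adj;
  adj_irrefl : irreflexive adj
}.

Definition independent (G : sgraph) (A : {set G}) : bool :=
  [forall x in A, forall y in A, ~~ adj x y].

Definition indep_num (G : sgraph) : nat :=
  \max_(A : {set G} | independent A) #|A|.

(* The edge xy is the unordered pair [set x; y]; the values of a coloring on
   sets which are not edges are never used.  Not every color need occur. *)
Definition edge_coloring (G : sgraph) (r : nat) := {set G} -> 'I_r.

(* A not necessarily induced subgraph, with at least one vertex. *)
Record subgraph (G : sgraph) := Subgraph {
  sverts : {set G};
  sadj : rel G;
  sverts_neq0 : sverts != set0;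
  sadj_sym : symmetric sadj;
  sadj_sub : forall x y, sadj x y -> [/\ x \in sverts, y \in sverts & adj x y]
}.

Definition monochromatic (G : sgraph) (r : nat) (c : edge_coloring G r)
    (H : subgraph G) : Prop :=
  forall x y x' y' : G,
    sadj H x y -> sadj H x' y' -> c [set x; y] = c [set x'; y'].

Definition connected_subgraph (G : sgraph) (H : subgraph G) : Prop :=
  {in sverts H &, forall u v, connect (sadj H) u v}.

Definition is_least (P : nat -> Prop) (m : nat) : Prop :=
  P m /\ forall n, P n -> m <= n.

(* Distances are relational: [is_dist H u v n] holds for no n when v is not
   reachable from u in H, i.e. when the distance is infinite; likewise for
   [is_diam] below. *)
Definition has_path (G : sgraph) (H : subgraph G) (u v : G) (n : nat) : Prop :=
  exists p : seq G,
    [/\ path (sadj H) u p, uniq (u :: p), last u p = v & size p = n].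

Definition is_dist (G : sgraph) (H : subgraph G) (u v : G) (n : nat) : Prop :=
  is_least (has_path H u v) n.

Definition dist_le (G : sgraph) (H : subgraph G) (u v : G) (d : nat) : Prop :=
  exists2 n, is_dist H u v n & n <= d.

Definition is_diam (G : sgraph) (H : subgraph G) (D : nat) : Prop :=
  is_least (fun d => {in sverts H &, forall u v, dist_le H u v d}) D.

Definition diam_le (G : sgraph) (H : subgraph G) (d : nat) : Prop :=
  exists2 D, is_diam H D & D <= d.

(* The members of the family F may coincide or overlap. *)
Definition covers (G : sgraph) (k : nat) (F : 'I_k -> subgraph G) : Prop :=
  \bigcup_(i < k) sverts (F i) = [set: G].

(* [is_g r d alpha k] : k is the minimum defining g(r, d, alpha). *)
Definition is_g (r d alpha k : nat) : Prop :=
  is_least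
    (fun k' => forall (G : sgraph) (c : edge_coloring G r),
       indep_num G = alpha ->
       exists F : 'I_k' -> subgraph G,
         (forall i, monochromatic c (F i) /\ diam_le (F i) d) /\ covers F)
    k.

(* Main.v *)
Require Import Defs.
From mathcomp Require Import all_boot.
From Stdlib Require Import Classical.

(** The closed neighbourhoods of a maximum independent set A cover G, since a
    vertex with no neighbour in A could be added to A.  The closed neighbourhood
    of each a in A is the union over the r colors i of the star formed by a and
    the edges of color i at a, and a star has diameter at most 2. *)

Set Implicit Arguments.
Unset Strict Implicit.
Unset Printing Implicit Defensive.

(** Strong induction on [n]: either a smaller witness exists, or [n] is already least. Excluded
    middle makes the choice because [P] need not be decidable. This one principle yields distances,
    diameters and the value of g. *)
Lemma is_least_exists (P : nat -> Prop) (n : nat) :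
  P n -> exists2 m, is_least P m & m <= n.
Proof.
elim/ltn_ind: n => n IHn Pn.
have [[m [lt_mn Pm]] | noP] := classic (exists m, m < n /\ P m).
  have [k k_least le_km] := IHn m lt_mn Pm.
  by exists k => //; apply: leq_trans le_km (ltnW lt_mn).
exists n => //; split=> // m Pm; rewrite leqNgt; apply/negP => lt_mn.
by apply: noP; exists m.
Qed.

(** Passing to minima twice only lowers the bound: the distance is at most the length of any given
    path, and the diameter is at most any common bound on distances. *)
Lemma diam_le_paths (G : sgraph) (H : subgraph G) (d : nat) :
  {in sverts H &, forall u v, exists2 n, has_path H u v n & n <= d} ->
  diam_le H d.
Proof.
move=> paths; apply: is_least_exists => u v uH vH.
have [n pathn le_nd] := paths u v uH vH.
have [m m_dist le_mn] := is_least_exists pathn.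
by exists m => //; apply: leq_trans le_mn le_nd.
Qed.

Lemma connected_paths (G : sgraph) (H : subgraph G) :
  {in sverts H &, forall u v, exists n, has_path H u v n} ->
  connected_subgraph H.
Proof.
move=> paths u v uH vH; have [_ [p [up _ up_v _]]] := paths u v uH vH.
by apply/connectP; exists p.
Qed.

Section Star.

Variables (G : sgraph) (r : nat) (c : edge_coloring G r) (a : G) (i : 'I_r).

(** The centre belongs unconditionally, so a color absent at [a] still gives a legitimate one-vertex
    subgraph. *)
Definition star_verts : {set G} :=
  [set x | (x == a) || adj a x && (c [set a; x] == i)].

Definition star_adj : rel G :=
  fun x y => [&& adj x y, c [set x; y] == i & (x == a) || (y == a)].

Lemma star_verts_neq0 : star_verts != set0.
Proof. by apply/set0Pn; exists a; rewrite inE eqxx. Qed.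

Lemma star_adj_sym : symmetric star_adj.
Proof. by move=> x y; rewrite /star_adj adj_sym setUC orbC. Qed.

Lemma star_adj_sub x y :
  star_adj x y -> [/\ x \in star_verts, y \in star_verts & adj x y].
Proof.
case/and3P=> xy cxy /orP[] /eqP eq_a; subst; split=> //;
  rewrite inE ?eqxx // ?xy ?cxy ?orbT //.
by rewrite adj_sym xy setUC cxy orbT.
Qed.

Definition star : subgraph G :=
  Subgraph star_verts_neq0 star_adj_sym star_adj_sub.

Lemma star_monochromatic : monochromatic c star.
Proof. by move=> x y x' y' /and3P[_ /eqP-> _] /and3P[_ /eqP-> _]. Qed.

Lemma star_paths :
  {in sverts star &, forall u v, exists2 n, has_path star u v n & n <= 2}.
Proof.
have center x : x \in star_verts -> x != a -> star_adj a x.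
  by rewrite inE /star_adj eqxx andbT => /orP[/eqP-> /eqP|].
move=> u v uH vH; have [<- | neq_uv] := eqVneq u v.
  by exists 0 => //; exists [::].
(* Paths must have distinct vertices, so the route from [u] through [a] to [v] serves only when both
   ends differ from [a]; an end at the centre is handled by a single edge. *)
have [eq_ua | neq_ua] := eqVneq u a.
  exists 1 => //; exists [:: v]; split=> //=; last by rewrite inE neq_uv.
  by rewrite eq_ua center // -eq_ua eq_sym.
have ua : star_adj u a by rewrite star_adj_sym center.
have [-> | neq_va] := eqVneq v a.
  by exists 1 => //; exists [:: a]; split; rewrite //= ?ua // inE neq_ua.
exists 2 => //; exists [:: a; v]; split=> //=; first by rewrite ua center.
by rewrite !inE negb_or neq_ua neq_uv eq_sym neq_va.
Qed.

Lemma star_diam : diam_le star 2.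
Proof. exact: diam_le_paths star_paths. Qed.

Lemma star_connected : connected_subgraph star.
Proof.
apply: connected_paths => u v uH vH.
by have [n pathn _] := star_paths uH vH; exists n.
Qed.

End Star.

Lemma max_independent_exists (G : sgraph) :
  exists2 A : {set G}, independent A & #|A| = indep_num G.
Proof.
(* A maximum over a nonempty range is attained; the empty set shows that the range is nonempty. *)
have ind0 : 0 < #|[pred A : {set G} | independent A]|.
  apply/card_gt0P; exists set0; rewrite inE.
  by apply/forall_inP => x; rewrite inE.
by have [A indA maxA] := eq_bigmax_cond (fun A : {set G} => #|A|) ind0; exists A.
Qed.

Lemma max_independent_dominating (G : sgraph) (A : {set G}) (x : G) :
  independent A -> #|A| = indep_num G ->
  exists2 a, a \in A & (x == a) || adj a x.
Proof.
move=> indA maxA; apply/exists_inP; apply: contraT.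
rewrite negb_exists_in => /forall_inP nbr.
have xNA : x \notin A by apply/negP => /nbr; rewrite eqxx.
have nadj a : a \in A -> ~~ adj a x by move/nbr; rewrite negb_or => /andP[].
have indxA : independent (x |: A).
  apply/forall_inP => y /setU1P[-> | yA]; apply/forall_inP => z /setU1P[-> | zA].
  - by rewrite adj_irrefl.
  - by rewrite adj_sym nadj.
  - exact: nadj.
  - by move/forall_inP: indA => /(_ y yA)/forall_inP/(_ z zA).
have : #|x |: A| <= indep_num G by apply: leq_bigmax_cond.
by rewrite -maxA cardsU1 xNA ltnn.
Qed.

Lemma star_cover (G : sgraph) (r : nat) (c : edge_coloring G r) :
  0 < r ->
  exists F : 'I_(r * indep_num G) -> subgraph G,
    (forall i, [/\ monochromatic c (F i),
                   connected_subgraph (F i)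
                 & diam_le (F i) 2])
    /\ covers F.
Proof.
move=> r_gt0; have [A indA maxA] := max_independent_exists G.
(* The stars are naturally indexed by pairs of a color and a centre in [A]; this count lets [p]
   renumber them by an ordinal. *)
have cardI : r * indep_num G = #|{: 'I_r * {a | a \in A}}|.
  by rewrite card_prod card_ord card_sig -maxA.
pose p k : 'I_r * {a | a \in A} := enum_val (cast_ord cardI k).
exists (fun k => star c (val (p k).2) (p k).1); split=> [k|].
  by split; [apply: star_monochromatic | apply: star_connected | apply: star_diam].
apply/setP => x; rewrite inE.
have [a aA xa] := max_independent_dominating x indA maxA.
have [i xi] : exists i, x \in star_verts c a i.
  (* A centre lies in its stars of all colors, so color 0 will do; it exists since [r] is
     positive. *)
  case/orP: xa => [/eqP-> | ax]; first by exists (Ordinal r_gt0); rewrite inE eqxx.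
  by exists (c [set a; x]); rewrite inE ax eqxx orbT.
apply/bigcupP; exists (cast_ord (esym cardI) (enum_rank (i, exist _ a aA))) => //.
by rewrite /p cast_ordKV enum_rankK.
Qed.

Theorem mainTheorem4 (r alpha : nat) (hr : 2 <= r) (halpha : 1 <= alpha) :
  (forall (G : sgraph) (c : edge_coloring G r),
     indep_num G = alpha ->
     exists F : 'I_(r * alpha) -> subgraph G,
       (forall i, [/\ monochromatic c (F i),
                      connected_subgraph (F i)
                    & diam_le (F i) 2])
       /\ covers F)
  /\ (exists2 k, is_g r 2 alpha k & k <= r * alpha).
Proof.
have cover (G : sgraph) (c : edge_coloring G r) : indep_num G = alpha ->
    exists F : 'I_(r * alpha) -> subgraph G,
      (forall i, [/\ monochromatic c (F i),
                     connected_subgraph (F i)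
                   & diam_le (F i) 2])
      /\ covers F.
  by move=> <-; apply: star_cover; apply: ltnW.
(* Since [r * alpha] is an admissible number of subgraphs, the minimum defining g exists and does
   not exceed it. *)
split=> //; apply: is_least_exists => G c alphaG.
have [F [propF covF]] := cover G c alphaG.
by exists F; split=> // i; have [] := propF i.
Qed.
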